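(* Let $\mathcal{M}$ be a simple oriented matroid (no loops, no parallel or antiparallel elements) on the ground set $E_t=\{1,\ldots,t\}$ which is not acyclic, and let $\mathcal{T}$ be its set of topes. Let $k$ be an integer with $3\leq k\leq|\mathcal{T}|/2$. Then: (i) \[ \#\mathring{\mathbf{K}}{}^{\ast}_k(\mathcal{M})= \sum_{\mathcal{G}}\mu_{\mathring{\boldsymbol{\mathcal{C}}}}(\hat{0},\mathcal{G})\cdot\sum_{G\in\mathring{\boldsymbol{\mathcal{E}}}(\mathcal{G}):\ 0<|G|\leq k}\mu_{\mathring{\boldsymbol{\mathcal{E}}}}(\hat{0},G)\cdot 2^{k-|G|}\cdot\binom{\frac{1}{2}|\mathcal{T}|-|G|}{k-|G|}\ , \] where the outer sum runs over all families $\mathcal{G}$ of the form $\bigcup_{e\in E}\binom{\mathcal{T}^+_e}{\lceil(k+1)/2\rceil}$ with $E\subseteq E_t$, $|E|>0$, and $\mu_{\mathring{\boldsymbol{\mathcal{C}}}}$ is the Möbius function of the poset $\mathring{\boldsymbol{\mathcal{C}}}:=\{\hat0\}\,\dot\cup\,\bigl\{\bigcup_{e\in E}\binom{\mathcal{T}^+_e}{\lceil(k+1)/2\rceil}: E\subseteq E_t,\ |E|>0\bigr\}$ ordered by inclusion (with $\hat0$ a new least element); (ii) \[ \#\mathring{\mathbf{K}}{}^{\ast}_k(\mathcal{M})= \sum_{\mathcal{G}}(-1)^{\#\mathcal{G}}\cdot\mu_{\mathcal{S}(\mathcal{G})}(\hat{0},\hat{1})\cdot 2^{k-|\bigcup_{G\in\mathcal{G}}G|}\cdot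 \binom{\frac{1}{2}|\mathcal{T}|-|\bigcup_{G\in\mathcal{G}}G|}{k-|\bigcup_{G\in\mathcal{G}}G|}\ , \] where the sum runs over all families $\mathcal{G}\subseteq\bigcup_{e\in E_t}\binom{\mathcal{T}^+_e}{\lceil(k+1)/2\rceil}$ with $1<\#\mathcal{G}\leq\binom{k}{\lceil(k+1)/2\rceil}$, $\bigcup_{G\in\mathcal{G}}G$ free of opposites, $\bigcup_{F\in\min\gamma_k(\mathcal{G})}F=E_t$, and $|\bigcup_{G\in\mathcal{G}}G|\leq k$. In particular, if for every family $\mathcal{G}\subseteq\bigcup_{e\in E_t}\binom{\mathcal{T}^+_e}{\lceil(k+1)/2\rceil}$ such that $\bigcup_{G\in\mathcal{G}}G$ is free of opposites, $\bigcup_{F\in\min\gamma_k(\mathcal{G})}F=E_t$ and $|\bigcup_{G\in\mathcal{G}}G|\leq k$, one has $|\gamma_k(G)|=1$ for every $G\in\mathcal{G}$, then \[ \#\mathring{\mathbf{K}}{}^{\ast}_k(\mathcal{M})=(-1)^t\cdot \sum_{\mathcal{G}}(-1)^{\#\mathcal{G}}\cdot 2^{k-|\bigcup_{G\in\mathcal{G}}G|}\cdot \binom{\frac{1}{2}|\mathcal{T}|-|\bigcup_{G\in\mathcal{G}}G|}{k-|\bigcup_{G\in\mathcal{G}}G|}\ , \] where the sum runs over all families $\mathcal{G}\subseteq\bigcup_{e\in E_t}\binom{\mathcal{T}^+_e}{\lceil(k+1)/2\rceil}$ with $t\leq\#\mathcal{G}\leq\binom{k}{\lceil(k+1)/2\rceil}$,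 $\bigcup_{G\in\mathcal{G}}G$ free of opposites, $\bigcup_{F\in\min\gamma_k(\mathcal{G})}F=E_t$ and $|\bigcup_{G\in\mathcal{G}}G|\leq k$.
   Context: Topes are the maximal covectors of $\mathcal{M}$, viewed as sign vectors $T\in\{+,-\}^{E_t}$; $\mathcal{T}=-\mathcal{T}$. A set of topes is free of opposites if it contains no pair $T,-T$. For $e\in E_t$, $\mathcal{T}^+_e:=\{T\in\mathcal{T}: T(e)=+\}$, and for $A\subseteq E_t$, $\mathcal{T}^+_A:=\bigcap_{a\in A}\mathcal{T}^+_a$. $\binom{S}{j}$ is the family of $j$-subsets of a set $S$. A tope committee of cardinality $k$ is a set $\mathcal{K}^{\ast}\subset\mathcal{T}$ with $|\mathcal{K}^{\ast}|=k$ and $|\mathcal{K}^{\ast}\cap\mathcal{T}^+_e|>k/2$ for all $e\in E_t$; $\mathring{\mathbf{K}}{}^{\ast}_k(\mathcal{M})$ denotes the family of tope committees of cardinality $k$ that are free of opposites. For a family $\mathcal{G}$ of opposite-free subsets of $\mathcal{T}$, $\mathring{\boldsymbol{\mathcal{E}}}(\mathcal{G})$ is the poset of all unions $\bigcup_{F\in\mathcal{F}}F$ over nonempty subfamilies $\mathcal{F}\subseteq\mathcal{G}$ whose union is free of opposites, ordered by inclusion, with a new least element $\hat0$ adjoined; $\mu_{\mathring{\boldsymbol{\mathcal{E}}}}$ is its Möbius function. A subset $A\subseteq E_t$ is convex if there is no signed circuit $X$ of $\mathcal{M}$ with $X^+\subseteq A$ and $X^-=\{e\}$ for some $e\notin A$.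 For a set $d$ of $\lceil(k+1)/2\rceil$ topes contained in some positive halfspace, $\gamma_k(d)$ is the inclusion-maximum convex subset $A\subseteq E_t$ with $d\subseteq\mathcal{T}^+_A$ (equivalently, $\gamma_k(d)=\{e\in E_t: T(e)=+\ \forall T\in d\}$). For a family $\mathcal{G}$ of such sets, $\gamma_k(\mathcal{G}):=\{\gamma_k(G):G\in\mathcal{G}\}$ and $\min\gamma_k(\mathcal{G})$ is its subfamily of inclusion-minimal members. When $\bigcup_{F\in\min\gamma_k(\mathcal{G})}F=E_t$, $\mathcal{S}(\mathcal{G})$ is the lattice of all unions $\bigcup_{F\in\mathcal{F}}F$ over nonempty $\mathcal{F}\subseteq\min\gamma_k(\mathcal{G})$, ordered by inclusion, with a new least element $\hat0$ adjoined; its greatest element $\hat1$ is $E_t$, and $\mu_{\mathcal{S}(\mathcal{G})}(\hat0,\hat1)$ is its Möbius number. *)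

(* Defs.v *)
From HB Require Import structures.
From mathcomp Require Import all_boot all_order all_algebra.

Set Implicit Arguments.
Unset Strict Implicit.
Unset Printing Implicit Defensive.

Import Order.TTheory GRing.Theory Num.Theory.
Local Open Scope ring_scope.

Inductive sign := Neg | Zero | Pos.

Definition sign_code (s : sign) : option bool :=
  match s with Neg => Some false | Zero => None | Pos => Some true end.
Definition sign_decode (o : option bool) : sign :=
  match o with Some false => Neg | None => Zero | Some true => Pos end.
Lemma sign_codeK : cancel sign_code sign_decode. Proof. by case. Qed.
HB.instance Definition _ := Finite.copy sign (can_type sign_codeK).

Definition sopp (s : sign) : sign :=
  match s with Neg => Pos | Zero => Zero | Pos => Neg end.
Definition smul (s r : sign) : sign :=
  match s with Neg => sopp r | Zero => Zero | Pos => r end.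

Notation signvec E := {ffun E -> sign}.

Section SignVectors.
Variable E : finType.
Implicit Types X Y : signvec E.

Definition sv0 : signvec E := [ffun => Zero].
Definition svopp X : signvec E := [ffun e => sopp (X e)].
Definition svcomp X Y : signvec E := [ffun e => if X e == Zero then Y e else X e].
Definition separation X Y : {set E} :=
  [set e | (X e != Zero) && (X e == sopp (Y e))].
Definition svpos X : {set E} := [set e | X e == Pos].
Definition svneg X : {set E} := [set e | X e == Neg].
Definition svsupp X : {set E} := [set e | X e != Zero].
Definition sv_le X Y : bool := [forall e, (X e == Zero) || (X e == Y e)].
Definition orthogonal X Y : bool :=
  [forall e, smul (X e) (Y e) == Zero] ||
  [exists e, smul (X e) (Y e) == Pos] && [exists e, smul (X e) (Y e) == Neg].

End SignVectors.

Arguments sv0 {E}.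

(* Covector axioms (L0)-(L3) of Bjorner, Las Vergnas, Sturmfels, White, Ziegler. *)
Record oriented_matroid (E : finType) := OrientedMatroid {
  covectors : {set signvec E};
  covector0 : sv0 \in covectors;
  covectorN : forall X, X \in covectors -> svopp X \in covectors;
  covector_comp : forall X Y,
    X \in covectors -> Y \in covectors -> svcomp X Y \in covectors;
  covector_elim : forall X Y e,
    X \in covectors -> Y \in covectors -> e \in separation X Y ->
    exists Z, [/\ Z \in covectors, Z e = Zero &
                  forall f, f \notin separation X Y -> Z f = svcomp X Y f]
}.

Section OrientedMatroids.
Variables (E : finType) (M : oriented_matroid E).

Definition vectors : {set signvec E} :=
  [set X | [forall Y in covectors M, orthogonal X Y]].

(* The signed circuits are the support-minimal nonzero vectors. *)
Definition circuits : {set signvec E} :=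
  [set X in vectors | (X != sv0) &&
    [forall Y in vectors, (Y != sv0) ==> ~~ (svsupp Y \proper svsupp X)]].

Definition loop (e : E) : bool := [forall X in covectors M, X e == Zero].
Definition parallel (e f : E) : bool := [forall X in covectors M, X e == X f].
Definition antiparallel (e f : E) : bool :=
  [forall X in covectors M, X e == sopp (X f)].

Definition simple_om : Prop :=
  (forall e, ~~ loop e) /\
  (forall e f, e != f -> ~~ parallel e f /\ ~~ antiparallel e f).

(* No positive circuit. *)
Definition acyclic : bool := [forall X in circuits, svneg X != set0].

Definition topes : {set signvec E} :=
  [set T in covectors M | [forall Y in covectors M, sv_le T Y ==> (Y == T)]].

Definition halfspace (e : E) : {set signvec E} := [set T in topes | T e == Pos].

(* Intersecting with [topes] only matters for [A = set0]. *)
Definition halfspaces (A : {set E}) : {set signvec E} :=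
  topes :&: \bigcap_(a in A) halfspace a.

Definition opposite_free (S : {set signvec E}) : bool :=
  [forall T in S, svopp T \notin S].

Definition committees (k : nat) : {set {set signvec E}} :=
  [set K : {set signvec E} | [&& K \subset topes, #|K| == k &
               [forall e, (k < 2 * #|K :&: halfspace e|)%N]]].

Definition opposite_free_committees (k : nat) : {set {set signvec E}} :=
  [set K in committees k | opposite_free K].

Definition convex (A : {set E}) : bool :=
  ~~ [exists X in circuits, exists e,
       [&& svpos X \subset A, svneg X == [set e] & e \notin A]].

(* The default value [set0] is never used when [M] is simple, see [gammaE]. *)
Definition gamma (d : {set signvec E}) : {set E} :=
  odflt set0 [pick A : {set E} |
    [&& convex A, d \subset halfspaces A &
        [forall B : {set E},
           convex B && (d \subset halfspaces B) ==> (B \subset A)]]].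

Definition halfspace_subsets (j : nat) (A : {set E}) : {set {set signvec E}} :=
  \bigcup_(e in A) [set d : {set signvec E} | (d \subset halfspace e) && (#|d| == j)].

End OrientedMatroids.

Section Moebius.
Variables (T : finType) (le : rel T) (P : {set T}).

(* Recursion along chains of the subposet [P]; such a chain has at most [#|P|]
   elements, so the fuel in [mobius] is sufficient, see [mobius_sum]. *)
Fixpoint mobius_rec (n : nat) (x y : T) : int :=
  if x == y then 1 else
  if n is n'.+1 then
    if le x y then
      - \sum_(z in P | [&& le x z, le z y & z != y]) mobius_rec n' x z
    else 0
  else 0.

Definition mobius (x y : T) : int := mobius_rec #|P| x y.

Lemma mobius_refl x : mobius x x = 1.
Proof. by rewrite /mobius; case: #|P| => [|n] /=; rewrite eqxx. Qed.

Hypotheses (le_refl : reflexive le) (le_anti : antisymmetric le)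
           (le_trans : transitive le).

Let itv x y := [set z in P | le x z && le z y].

Let itv_lt x y z : y \in P -> le x y -> le z y -> z != y ->
  (#|itv x z| < #|itv x y|)%N.
Proof.
move=> yP xy zy nzy; apply/proper_card/properP; split.
  apply/subsetP => w; rewrite !inE => /and3P[-> -> wz] /=; exact: le_trans zy.
exists y; first by rewrite !inE yP xy le_refl.
rewrite !inE yP xy /=; apply: contra nzy => yz.
by apply/eqP/le_anti; rewrite zy yz.
Qed.

Let mobius_rec_stable n m x y : y \in P ->
  (#|itv x y| <= n)%N -> (#|itv x y| <= m)%N ->
  mobius_rec n x y = mobius_rec m x y.
Proof.
have itv0 u v : v \in P -> le u v -> (#|itv u v| <= 0)%N = false.
  move=> vP uv; apply/negbTE; rewrite -ltnNge; apply/card_gt0P.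
  by exists v; rewrite !inE vP uv le_refl.
elim: n m x y => [|n IHn] [|m] x y yP hn hm //=; case: eqVneq => // nxy;
  case: ifP => // xy.
- by move: hn; rewrite itv0.
- by move: hm; rewrite itv0.
congr (- _); apply: eq_bigr => z /and4P[zP xz zy nzy].
have lt := itv_lt yP xy zy nzy.
by apply: IHn => //; rewrite -ltnS; apply: leq_trans lt _.
Qed.

Lemma mobius_sum x y : x \in P -> y \in P -> x != y -> le x y ->
  \sum_(z in P | le x z && le z y) mobius x z = 0.
Proof.
move=> xP yP nxy xy.
have hP u v : (#|itv u v| <= #|P|)%N.
  by apply/subset_leq_card/subsetP => w; rewrite inE => /andP[].
rewrite (bigD1 y) ?yP ?xy ?le_refl //=.
rewrite {1}/mobius (mobius_rec_stable (m := #|P|.+1)) ?leqW //=.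
rewrite (negbTE nxy) xy addrC; apply/eqP; rewrite subr_eq0; apply/eqP.
by apply: eq_bigl => z; rewrite -!andbA.
Qed.

End Moebius.

(* [None] is the adjoined least element. *)
Definition hat0_le (X : finType) (x y : option {set X}) : bool :=
  match x, y with
  | None, _ => true
  | Some _, None => false
  | Some A, Some B => A \subset B
  end.

Definition hat0_poset (X : finType) (S : {set {set X}}) : {set option {set X}} :=
  None |: [set Some A | A in S].

Definition mobius_hat0 (X : finType) (S : {set {set X}}) (A : {set X}) : int :=
  mobius (@hat0_le X) (hat0_poset S) None (Some A).

Definition unions (X : finType) (F : {set {set X}}) : {set {set X}} :=
  [set cover F' | F' : {set {set X}} in powerset F & F' != set0].

Definition min_members (X : finType) (F : {set {set X}}) : {set {set X}} :=
  [set A | minset (fun B : {set X} => B \in F) A].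

(* The posets below are given without their adjoined least element, which
   [mobius_hat0] supplies. *)
Section CommitteePosets.
Variables (E : finType) (M : oriented_matroid E).

Definition posetC (j : nat) : {set {set {set signvec E}}} :=
  [set halfspace_subsets M j A | A : {set E} in ~: [set set0]].

Definition posetE (G : {set {set signvec E}}) : {set {set signvec E}} :=
  [set U in unions G | opposite_free U].

Definition min_gamma (G : {set {set signvec E}}) : {set {set E}} :=
  min_members [set gamma M d | d in G].

Definition posetS (G : {set {set signvec E}}) : {set {set E}} :=
  unions (min_gamma G).

End CommitteePosets.

Section GammaE.
Variables (E : finType) (M : oriented_matroid E).
Hypothesis simpleM : simple_om M.

Lemma tope_neq0 (T : signvec E) e : T \in topes M -> T e != Zero.
Proof.
rewrite inE => /andP[TL /forall_inP maxT].
have /forall_inPn[Y YL Ye] := simpleM.1 e.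
apply: contra Ye => /eqP Te.
have /implyP H := maxT _ (covector_comp TL YL).
have /eqP/ffunP/(_ e) : svcomp T Y == T.
  by apply: H; apply/forallP => f; rewrite ffunE; case: eqP => //= _; rewrite eqxx.
by rewrite ffunE Te eqxx => ->.
Qed.

Lemma gammaE (d : {set signvec E}) : d \subset topes M ->
  gamma M d = [set e | [forall T in d, T e == Pos]].
Proof.
move=> dT; set A := [set e | _].
have sub B : (d \subset halfspaces M B) = (B \subset A).
  apply/subsetP/subsetP => [H e eB|H T Td].
    rewrite inE; apply/forall_inP => T /H; rewrite inE => /andP[_ /bigcapP/(_ e eB)].
    by rewrite inE => /andP[].
  have TT := subsetP dT _ Td.
  rewrite inE TT; apply/bigcapP => e /H; rewrite inE => /forall_inP/(_ T Td) Te.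
  by rewrite inE TT.
have convA : convex M A.
  apply/negP => /exists_inP[X XC /existsP[e /and3P[XA /eqP Xe]]].
  rewrite inE => /forall_inPn[T Td Te].
  have TT := subsetP dT _ Td.
  have TL : T \in covectors M by move: TT; rewrite inE => /andP[].
  have XeN : X e = Neg.
    by apply/eqP; have := set11 e; rewrite -Xe inE.
  have TeN : T e = Neg by move: Te (tope_neq0 e TT); case: (T e).
  move: XC; rewrite !inE => /andP[/forall_inP/(_ T TL) + _].
  case/orP => [/forallP/(_ e)|/andP[_ /existsP[f]]]; first by rewrite XeN TeN.
  case Xf: (X f) => //=.
    have: f \in svneg X by rewrite inE Xf.
    by rewrite Xe inE => /eqP ->; rewrite TeN.
  have: f \in A by apply: (subsetP XA); rewrite inE Xf.
  by rewrite inE => /forall_inP/(_ T Td)/eqP ->.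
rewrite /gamma; case: pickP => [B /and3P[_ dB /forallP/(_ A)]|/(_ A)] /=.
  rewrite convA !sub subxx /= => AB.
  by apply/eqP; rewrite eqEsubset AB -sub dB.
rewrite convA sub subxx /= => /negP[].
by apply/forallP => B; rewrite sub; apply/implyP => /andP[].
Qed.

End GammaE.

(* Main.v *)
Require Import Defs.
From mathcomp Require Import all_boot all_order all_algebra.
From mathcomp Require Import zify.
Import Order.TTheory GRing.Theory Num.Theory.
Local Open Scope ring_scope.

(** An opposite-free set [U] of [u] topes lies in [2^(k-u) * C(|T|/2 - u, k-u)]
    opposite-free [k]-sets of topes, so both formulas reduce, after exchanging
    sums, to identities for a fixed opposite-free [k]-set [K]: a sum over the
    families of [j]-subsets contained in [K] must be the indicator of "[K] is a
    committee". The Moebius numbers are expanded by the crosscut formula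
    [mu (0, U) = sum of (-1)^|F| over the families F of atoms with union U].
    For (i) what remains is inclusion-exclusion over the elements [e] with fewer
    than [j] topes of [K] in their halfspace. For (ii) one sums over pairs [F, G]
    with [F] contained in [min gamma(G)]; for fixed [F] the alternating sum over
    [G] vanishes unless [F] consists of the maximal members of
    [gamma(D_K)], where [D_K] is the set of admissible [j]-subsets of [K], and
    this [F] covers the ground set exactly when [K] is a committee. The term
    [#|G| = 1] is absent because a cyclic oriented matroid has no positive tope. *)

(** * Alternating sums over families of sets *)

Lemma sum_sign_interval (X : finType) (A B : {set X}) :
  \sum_(F : {set X} | (A \subset F) && (F \subset B)) (-1) ^+ #|F|
    = (-1) ^+ #|B| * (A == B)%:R :> int.
Proof.
have [<-|neqAB] := eqVneq A B.
  rewrite mulr1 (big_pred1 A) // => F /=.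
  by rewrite eqEsubset andbC.
rewrite mulr0.
have [sAB|nsAB] := boolP (A \subset B); last first.
  apply: big_pred0 => F; apply: contraNF nsAB => /andP[].
  exact: subset_trans.
have /properP[_ [x xB xA]] : A \proper B.
  by rewrite properEneq neqAB.
(* Toggling [x], which lies in [B] but not in [A], is a sign-reversing pairing of the interval. *)
rewrite (bigID (fun F : {set X} => x \in F)) /=.
rewrite (reindex_onto (fun F => x |: F) (fun F => F :\ x)) /=; last first.
  by move=> F /andP[_ xF]; rewrite setD1K.
rewrite -[RHS](subrr (\sum_(F : {set X} | ((A \subset F) && (F \subset B)) && (x \notin F)) (-1) ^+ #|F|)).
rewrite addrC; congr (_ + _); rewrite -sumrN.
have xF (F : {set X}) : (x |: F) :\ x == F = (x \notin F).
  apply/eqP/idP => [<-|xF]; first by rewrite !inE eqxx.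
  by rewrite setU1K.
apply: eq_big => [F|F /andP[_]]; last first.
  by rewrite xF => xF'; rewrite cardsU1 xF' exprD expr1 mulN1r.
rewrite xF setU11 andbT subUset sub1set xB /=.
case xF': (x \in F); rewrite ?andbF // !andbT; congr (_ && _).
apply/subsetP/subsetP => H y yA; last by rewrite inE H ?orbT.
by have := H y yA; rewrite !inE => /predU1P[yx|//]; rewrite -yx yA in xA.
Qed.

Lemma sum_sign_subsets (X : finType) (B : {set X}) :
  \sum_(F : {set X} | F \subset B) (-1) ^+ #|F| = (B == set0)%:R :> int.
Proof.
rewrite -[RHS]mul1r; have := sum_sign_interval X set0 B.
under eq_bigl => F do rewrite sub0set.
move=> ->; rewrite eq_sym; case: eqP => [->|]; last by rewrite !mulr0.
by rewrite cards0.
Qed.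

Lemma sum_sign_nonempty_subsets (X : finType) (B : {set X}) :
  \sum_(F : {set X} | (F \subset B) && (F != set0)) (-1) ^+ #|F|
    = - (B != set0)%:R :> int.
Proof.
have := sum_sign_subsets X B; rewrite (bigD1 set0) ?sub0set //= cards0 expr0.
by move/eqP; rewrite addrC eq_sym -subr_eq => /eqP <-; case: eqP.
Qed.

(** The condition [F \subset f @: G] is itself written as an alternating sum over
    [F' \subset F :\: f @: G]. For fixed [F'] the sets [G] are the subsets of [D] avoiding the
    preimage of [F'], and their signs cancel unless [f @: D \subset F']. What remains is a sum over
    the interval from [f @: D] to [F]. *)
Lemma sum_sign_image (X Y : finType) (f : X -> Y) (D : {set X}) (F : {set Y}) :
  \sum_(G : {set X} | (G \subset D) && (F \subset f @: G)) (-1) ^+ #|G|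
    = (-1) ^+ #|F| * (f @: D == F)%:R :> int.
Proof.
rewrite big_mkcondr /=.
transitivity (\sum_(G : {set X} | G \subset D)
   \sum_(F' : {set Y} | F' \subset F :\: f @: G) (-1) ^+ #|G| * (-1) ^+ #|F'| : int).
  apply: eq_bigr => G GD; rewrite -mulr_sumr sum_sign_subsets setD_eq0.
  by case: ifP; rewrite ?mulr1 ?mulr0.
rewrite (exchange_big_dep (fun F' : {set Y} => F' \subset F)) /=; last first.
  by move=> G F' _; rewrite subsetD => /andP[].
rewrite -sum_sign_interval.
rewrite [RHS]big_mkcond /= [LHS]big_mkcond /=; apply: eq_bigr => F' _.
case: ifP => F'F; rewrite ?andbF // andbT.
rewrite (eq_bigl (fun G : {set X} => G \subset D :\: f @^-1: F')); last first.
  move=> G; rewrite !subsetD F'F /=; congr (_ && _).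
  rewrite disjoint_sym; apply/pred0P/pred0P => /= H x; apply/negP => /andP[].
    by move=> xG; rewrite !inE => fx; have /= := H (f x); rewrite imset_f // fx.
  by case/imsetP => y yG -> /= fy; have /= := H y; rewrite yG inE fy.
rewrite -mulr_suml sum_sign_subsets setD_eq0 sub_imset_pre.
by case: ifP; rewrite ?mul1r ?mul0r.
Qed.

(* Only the family of maximal members of [h @: D] satisfies the fixpoint
   equation left after exchanging the sums. *)
Lemma sum_sign_min_members (X Y : finType) (h : X -> {set Y}) (D : {set X})
    (C : {set Y}) :
  \sum_(G : {set X} | G \subset D) (-1) ^+ #|G| *
    \sum_(F : {set {set Y}} | (F \subset min_members (h @: G)) && (cover F == C))
      (-1) ^+ #|F|
  = (cover (h @: D) == C)%:R :> int.
Proof.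
pose D' (F : {set {set Y}}) := [set d in D | ~~ [exists f in F, h d \proper f]].
pose Fmax := [set A | maxset (fun B : {set Y} => B \in h @: D) A].
have subFmax A : A \in h @: D -> exists2 B, B \in Fmax & A \subset B.
  by case/(@maxset_exists _ (fun B => B \in h @: D)) => B mB sAB; exists B; rewrite ?inE.
have FmaxD A : A \in Fmax -> A \in h @: D by rewrite inE => /maxsetp.
have maxE A B : A \in Fmax -> B \in h @: D -> A \subset B -> B = A.
  by rewrite inE => /maxsetP[_]; apply.
under eq_bigr => G _ do rewrite mulr_sumr.
rewrite (exchange_big_dep (fun F : {set {set Y}} => cover F == C)) /=; last first.
  by move=> G F _ /andP[].
transitivity (\sum_(F : {set {set Y}} | cover F == C) (F == Fmax)%:R : int).
  apply: eq_bigr => F FC; rewrite FC.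
  (* All members of [F] are minimal in [h @: G] exactly when they occur there and no [d] in [G] has
     its image strictly below one of them. The second condition is [G \subset D' F], so
     [sum_sign_image] applies. *)
  rewrite (eq_bigl (fun G : {set X} => (G \subset D' F) && (F \subset h @: G))); last first.
    move=> G; rewrite andbT; apply/andP/andP => -[].
      move=> GD /subsetP FG; split; last first.
        by apply/subsetP => f /FG; rewrite inE => /minsetp.
      apply/subsetP => d dG; rewrite inE (subsetP GD) //=.
      apply/exists_inP => -[f /FG]; rewrite inE => /minsetP[_ mf] pdf.
      have := mf (h d) (imset_f _ dG) (proper_sub pdf) => edf.
      by rewrite edf properxx in pdf.
    move=> /subsetP GD /subsetP FG; split.
      by apply/subsetP => d /GD; rewrite inE => /andP[].
    apply/subsetP => f fF; rewrite inE; apply/minsetP; split; first exact: FG.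
    move=> B /imsetP[d dG ->] sdf; apply/eqP; apply: contraT => ndf.
    have := GD _ dG; rewrite inE => /andP[_ /exists_inPn/(_ f fF)].
    by rewrite properEneq ndf sdf.
  rewrite -mulr_suml sum_sign_image mulrC mulrA -expr2 sqrr_sign mul1r.
  (* The two signs have cancelled, leaving the equation [h @: D' F = F]. A maximal member is never
     filtered out by [D'], so [F] contains [Fmax]; any other member would lie strictly below an
     element of [Fmax] and be filtered out. *)
  congr (nat_of_bool _)%:R; apply/eqP/eqP => [DF|->].
    have FD A : A \in F -> A \in h @: D.
      by rewrite -DF => /imsetP[d]; rewrite inE => /andP[dD _] ->; apply: imset_f.
    have maxF A : A \in Fmax -> A \in F.
      move=> mA; have /imsetP[d dD Ad] := FmaxD _ mA.
      rewrite -DF Ad imset_f // inE dD /= -Ad.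
      apply/exists_inP => -[f fF pAf].
      by have := maxE _ _ mA (FD _ fF) (proper_sub pAf) => fA; rewrite fA properxx in pAf.
    apply/setP => A; apply/idP/idP => [AF|/maxF//].
    have [B mB sAB] := subFmax _ (FD _ AF).
    move: (AF); rewrite -DF => /imsetP[d]; rewrite inE => /andP[dD nd] Ad.
    suff -> : A = B by [].
    apply/eqP; apply: contraNT nd => nAB; apply/exists_inP; exists B; first exact: maxF.
    by rewrite -Ad properEneq nAB.
  apply/setP => A; apply/imsetP/idP => [[d]|mA].
    rewrite inE => /andP[dD /exists_inPn nd] ->.
    have [B mB sdB] := subFmax _ (imset_f h dD).
    by have := nd _ mB; rewrite properEneq sdB andbT negbK => /eqP ->.
  have /imsetP[d dD Ad] := FmaxD _ mA; exists d => //; rewrite inE dD -Ad /=.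
  apply/exists_inP => -[B mB pAB].
  have := maxE _ _ mA (FmaxD _ mB) (proper_sub pAB) => BA.
  by rewrite BA properxx in pAB.
have -> : cover (h @: D) = cover Fmax.
  apply/eqP; rewrite eqEsubset; apply/andP; split; apply/bigcupsP => A.
    by case/subFmax => B mB sAB; apply: subset_trans sAB _; apply: (bigcup_sup B).
  by move=> /FmaxD AD; apply: (bigcup_sup A).
rewrite big_mkcond /= (bigD1 Fmax) //= eqxx big1 ?addr0; first by case: eqP.
by move=> F /negPf ->; case: ifP.
Qed.

(** * Moebius numbers of families of sets with an adjoined least element *)

Section MobiusHat0.
Variable X : finType.
Implicit Types (S A : {set {set X}}) (U : {set X}).

(** This is the Moebius recursion with the term 1 of the adjoined element moved to the right-hand
    side. *)
Lemma mobius_hat0_sum S U : U \in S ->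
  \sum_(V in S | V \subset U) mobius_hat0 S V = -1.
Proof.
move=> US.
have le_refl : reflexive (@hat0_le X) by case=> [A|] //=.
have le_anti : antisymmetric (@hat0_le X).
  by move=> [A|] [B|] //= AB; congr Some; apply/eqP; rewrite eqEsubset.
have le_trans : transitive (@hat0_le X).
  by move=> [A|] [B|] [C|] //=; apply: subset_trans.
have := @mobius_sum _ (@hat0_le X) (hat0_poset S) le_refl le_anti le_trans None (Some U).
rewrite setU11 setU1r ?imset_f // => /(_ isT isT isT isT).
rewrite (bigD1 None) ?setU11 //= mobius_refl => /eqP; rewrite addrC addr_eq0 => /eqP <-.
rewrite (eq_bigl (fun z => (z \in [set Some A | A in S]) && hat0_le z (Some U))); last first.
  move=> [A|]; rewrite !inE /= ?andbT //.
  by apply/esym/negbTE/negP => /imsetP[].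
rewrite [RHS]big_mkcondr big_imset /=; last by move=> A B _ _ [].
by rewrite -big_mkcondr.
Qed.

(** The recursion determines its solution by induction on [#|U|], so a closed form only has to be
    checked against it. *)
Lemma mobius_hat0_unique S (f : {set X} -> int) :
    (forall U, U \in S -> \sum_(V in S | V \subset U) f V = -1) ->
  forall U, U \in S -> mobius_hat0 S U = f U.
Proof.
move=> fS U; have [n] := ubnP #|U|; elim: n U => // n IHn U ltUn US.
have := mobius_hat0_sum S U US; rewrite -(fS U US).
rewrite (bigD1 U) ?US ?subxx //= [in RHS](bigD1 U) ?US ?subxx //=.
rewrite (eq_bigr f); first by move/addIr.
move=> V /andP[/andP[VS sVU] nVU]; apply: IHn => //.
by rewrite -ltnS; apply: leq_trans ltUn; rewrite ltnS proper_card // properEneq nVU.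
Qed.

(* The crosscut formula, for a lower set of the union semilattice of [A]. *)
Lemma mobius_hat0_unions S A :
    S \subset unions A ->
    (forall U V, U \in S -> V \in unions A -> V \subset U -> V \in S) ->
  forall U, U \in S -> mobius_hat0 S U =
    \sum_(F : {set {set X}} | [&& F \subset A, F != set0 & cover F == U])
      (-1) ^+ #|F|.
Proof.
move=> sSA downS; apply: mobius_hat0_unique => U US.
have /imsetP[F0] := subsetP sSA _ US.
rewrite !inE => /andP[F0A F0n0] UF0.
pose B := [set d in A | d \subset U].
have subB (F : {set {set X}}) : (F \subset B) = (F \subset A) && (cover F \subset U).
  apply/subsetP/andP => [FB|[/subsetP FA /bigcupsP FU] d dF]; last first.
    by rewrite inE FA // FU.
  split; first by apply/subsetP => d /FB; rewrite inE => /andP[].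
  by apply/bigcupsP => d /FB; rewrite inE => /andP[].
have Bn0 : B != set0.
  apply: contraNneq F0n0 => B0; rewrite -subset0 -B0 subB F0A UF0.
  exact: subxx.
transitivity (- (B != set0)%:R : int); last by rewrite Bn0.
rewrite -sum_sign_nonempty_subsets.
(* The nonempty families of atoms below [U] are grouped by their union, which lies in [S] by
   [downS]; their total sign is -1, as the recursion demands. *)
rewrite [RHS](partition_big (@cover X) (fun V => (V \in S) && (V \subset U))) /=.
  apply: eq_bigr => V /andP[VS VU]; apply: eq_bigl => F; rewrite subB -!andbA.
  by case: (eqVneq (cover F) V) => [->|]; rewrite ?andbF ?VU.
move=> F; rewrite subB => /andP[/andP[FA FU] Fn0]; rewrite FU andbT.
apply: downS US _ FU; apply/imsetP; exists F => //.
by rewrite !inE FA.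
Qed.

End MobiusHat0.

(** A covering family of singletons consists of all singletons, and no proper subfamily covers. The
    crosscut sum thus has a single term. *)
Lemma mobius_hat0_unions_singletons (Y : finType) (B : {set {set Y}}) :
    [set: Y] != set0 -> cover B = setT -> {in B, forall A : {set Y}, #|A| = 1%N} ->
  mobius_hat0 (unions B) setT = (-1) ^+ #|Y|.
Proof.
move=> Yn0 covB B1.
have covBE (F : {set {set Y}}) : F \subset B -> cover F = setT -> F = B.
  move=> FB covF; apply/eqP; rewrite eqEsubset FB; apply/subsetP => A AB.
  have /eqP/cards1P[x Ax] := B1 _ AB.
  have /bigcupP[A' A'F xA'] : x \in cover F by rewrite covF inE.
  have /eqP/cards1P[y Ay] := B1 _ (subsetP FB _ A'F).
  by move: xA'; rewrite Ay Ax inE => /eqP ->; rewrite -Ay.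
have BE : B = [set [set y] | y in [set: Y]].
  apply/setP => A; apply/idP/imsetP => [AB|[y _ ->]].
    by have /eqP/cards1P[x ->] := B1 _ AB; exists x.
  have /bigcupP[A' A'B yA'] : y \in cover B by rewrite covB inE.
  have /eqP/cards1P[x Ax] := B1 _ A'B.
  by move: yA'; rewrite Ax inE => /eqP ->; rewrite -Ax.
have Bn0 : B != set0.
  by apply: contraNneq Yn0 => B0; rewrite -covB B0 /cover big_set0.
rewrite (@mobius_hat0_unions _ (unions B) B) //.
- rewrite (big_pred1 B) => [|F /=].
    by rewrite BE card_imset ?cardsT //; apply: set1_inj.
  apply/and3P/eqP => [[FB _ /eqP]|->]; first exact: covBE.
  by rewrite subxx Bn0 covB.
- by apply/imsetP; exists B; rewrite ?covB // !inE subxx.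
Qed.

(** * Counting opposite-free sets that contain a given set *)

Section OppositeFreeSets.
Variable E : finType.
Implicit Types (W U K : {set signvec E}) (T : signvec E).

Lemma svoppK : involutive (@svopp E).
Proof. by move=> T; apply/ffunP => e; rewrite !ffunE; case: (T e). Qed.

Lemma opposite_freeS U K : U \subset K -> opposite_free K -> opposite_free U.
Proof.
move=> /subsetP sUK /forall_inP freeK; apply/forall_inP => T /sUK /freeK.
by apply: contra => /sUK.
Qed.

Definition opposite_free_extensions W U (n : nat) : {set {set signvec E}} :=
  [set K : {set signvec E} |
    [&& K \subset W, U \subset K, opposite_free K & #|K| == n]].

Variable W : {set signvec E}.
Hypothesis oppW : {in W, forall T, svopp T \in W}.
Hypothesis opp_neq : {in W, forall T, svopp T != T}.

(** The addable elements are those outside [K] and its set of opposites, two disjoint subsets of [W]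
    of equal size. *)
Lemma card_addable K : K \subset W -> opposite_free K ->
  #|[set T in W | (T \notin K) && (svopp T \notin K)]| = (#|W| - 2 * #|K|)%N.
Proof.
move=> KW /forall_inP freeK.
have memN T : (T \in [set svopp S | S in K]) = (svopp T \in K).
  by rewrite -{1}(svoppK T) (mem_imset _ _ (inv_inj svoppK)).
have -> : [set T in W | (T \notin K) && (svopp T \notin K)]
    = W :\: (K :|: [set svopp S | S in K]).
  by apply/setP => T; rewrite !in_setD in_setU memN negb_or inE andbC.
have sub : K :|: [set svopp S | S in K] \subset W.
  rewrite subUset KW; apply/subsetP => T; rewrite memN => /(subsetP KW)/oppW.
  by rewrite svoppK.
rewrite cardsD (setIidPr sub) cardsU card_imset; last exact: inv_inj svoppK.
have -> : K :&: [set svopp S | S in K] = set0.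
  by apply/setP => T; rewrite in_setI memN inE; apply/negP => /andP[/freeK/negP].
by rewrite cards0 subn0 addnn mul2n.
Qed.

Lemma opposite_free_setU1 K T : T \in W -> K \subset W ->
  opposite_free (T |: K) = (svopp T \notin K) && opposite_free K.
Proof.
move=> TW KW; apply/idP/andP => [freeTK|[nTK /forall_inP freeK]].
  split; last by apply: opposite_freeS freeTK; apply: subsetUr.
  have /forall_inP/(_ T) := freeTK; rewrite setU11 => /(_ isT).
  by rewrite in_setU1 negb_or => /andP[].
apply/forall_inP => S; rewrite !in_setU1 negb_or => /predU1P[->|SK].
  by rewrite opp_neq.
rewrite freeK // andbT; apply: contraNneq nTK => <-.
by rewrite svoppK.
Qed.

(* Double counting of the pairs formed by an extension of size [n.+1] and one of
   its elements outside [U]. *)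
Lemma card_opposite_free_extensionsS U n :
  (\sum_(K in opposite_free_extensions W U n.+1) #|K :\: U| =
   \sum_(K in opposite_free_extensions W U n) (#|W| - 2 * #|K|))%N.
Proof.
transitivity (\sum_(K in opposite_free_extensions W U n)
    #|[set T in W | (T \notin K) && (svopp T \notin K)]|)%N; last first.
  apply: eq_bigr => K; rewrite inE => /and4P[KW _ freeK _].
  exact: card_addable.
under eq_bigr => K _ do rewrite -sum1_card.
under [RHS]eq_bigr => K _ do rewrite -sum1_card.
rewrite (exchange_big_dep predT) //= [RHS](exchange_big_dep predT) //=.
apply: eq_bigr => T _.
(* For fixed [T], deleting [T] matches the larger extensions having [T] outside [U] with the smaller
   ones to which [T] can be added. *)
rewrite (reindex_onto (fun K => T |: K) (fun K => K :\ T)) /=; last first.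
  by move=> K /andP[_]; rewrite inE => /andP[_ TK]; rewrite setD1K.
apply: eq_bigl => K.
have -> : ((T |: K) :\ T == K) = (T \notin K).
  apply/eqP/idP => [<-|TK]; first by rewrite !inE eqxx.
  by rewrite setU1K.
rewrite !inE eqxx /= andbT.
have [TK|TK] := boolP (T \in K); first by rewrite !andbF.
rewrite andbT /= subUset sub1set cardsU1 TK add1n eqSS.
have [TW|TW] := boolP (T \in W); last by rewrite !andbF.
have [KW|KW] := boolP (K \subset W); last by [].
rewrite opposite_free_setU1 //=.
have -> : [&& U \subset T |: K, (svopp T \notin K) && opposite_free K & #|K| == n]
    && (T \notin U) = ((U \subset T |: K) && (T \notin U)) &&
      [&& svopp T \notin K, opposite_free K & #|K| == n].
  by do ![case: (_ \in _) | case: (_ \subset _) | case: (opposite_free _) | case: (_ == _)].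
have -> : (U \subset T |: K) && (T \notin U) = (U \subset K).
  apply/andP/idP => [[/subsetP UTK TU]|UK].
    apply/subsetP => S SU; have := UTK _ SU; rewrite in_setU1 => /predU1P[ST|//].
    by rewrite -ST SU in TU.
  split; first by apply: subset_trans UK _; apply: subsetUr.
  by apply: contra TK; apply: (subsetP UK).
by rewrite -!andbA; do !bool_congr.
Qed.

(** Double counting gives the ratio of consecutive counts as [#|W| - 2 * (#|U| + r)] over [r.+1]. As
    [#|W|] is even, the numerator is twice [#|W| %/ 2 - #|U| - r], which is the recurrence of the
    binomial coefficients with an extra factor 2. *)
Lemma card_opposite_free_extensions U r :
    ~~ odd #|W| -> U \subset W -> opposite_free U ->
  #|opposite_free_extensions W U (#|U| + r)| = (2 ^ r * 'C(#|W| %/ 2 - #|U|, r))%N.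
Proof.
move=> evW UW freeU; elim: r => [|r IHr].
  rewrite addn0 bin0 muln1; apply/eqP/cards1P; exists U.
  apply/setP => K; rewrite !inE; apply/and4P/eqP => [[_ UK _ /eqP cK]|->].
    by apply/eqP; rewrite eq_sym eqEcard UK cK /=.
  by rewrite subxx.
have := card_opposite_free_extensionsS U (#|U| + r).
rewrite (eq_bigr (fun=> r.+1)); last first.
  move=> K; rewrite inE => /and4P[_ UK _ /eqP cK].
  by rewrite cardsD (setIidPr UK) cK subSn ?leq_addr // addKn.
rewrite sum_nat_const [RHS](eq_bigr (fun=> #|W| - 2 * (#|U| + r))%N); last first.
  by move=> K; rewrite inE => /and4P[_ _ _ /eqP ->].
rewrite sum_nat_const IHr addnS => card_eq; apply/eqP.
rewrite -(eqn_pmul2r (ltn0Sn r)) card_eq -!mulnA [('C(_, r.+1) * _)%N]mulnC.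
rewrite mul_bin_left expnSr -!mulnA eqn_pmul2l ?expn_gt0 // mulnA mulnC.
by rewrite eqn_mul2r; apply/orP; right; lia.
Qed.

(** All members of [G] lie in [K] exactly when [K] extends [cover G], so exchanging the sums counts
    extensions of [cover G]. There are none if [cover G] contains opposites or has more than [k]
    elements. *)
Lemma sum_opposite_free_sets (D : {set {set signvec E}})
    (w : {set {set signvec E}} -> int) (k : nat) :
    ~~ odd #|W| -> {in D, forall d : {set signvec E}, d \subset W} ->
  \sum_(K in opposite_free_extensions W set0 k)
    \sum_(G : {set {set signvec E}} | G \subset [set d in D | d \subset K]) w G
  = \sum_(G : {set {set signvec E}} |
          [&& G \subset D, opposite_free (cover G) & (#|cover G| <= k)%N])
      w G * (2 ^ (k - #|cover G|) * 'C(#|W| %/ 2 - #|cover G|, k - #|cover G|))%N%:Z.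
Proof.
move=> evW DW.
have subK (G : {set {set signvec E}}) K :
    (G \subset [set d in D | d \subset K]) = (G \subset D) && (cover G \subset K).
  apply/subsetP/andP => [GK|[/subsetP GD /bigcupsP GK] d dG]; last first.
    by rewrite inE GD // GK.
  split; first by apply/subsetP => d /GK; rewrite inE => /andP[].
  by apply/bigcupsP => d /GK; rewrite inE => /andP[].
rewrite (exchange_big_dep (fun G : {set {set signvec E}} => G \subset D)) /=; last first.
  by move=> K G _; rewrite subK => /andP[].
rewrite [RHS]big_mkcondr; apply: eq_bigr => G GD.
rewrite (eq_bigl (fun K => K \in opposite_free_extensions W (cover G) k)); last first.
  by move=> K; rewrite !inE sub0set subK GD /= -!andbA; do !bool_congr.
rewrite sumr_const -mulr_natr.
have covW : cover G \subset W by apply/bigcupsP => d /(subsetP GD)/DW.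
case: ifP => [/andP[freeG leGk]|notG].
  by rewrite -{1}(subnKC leGk) card_opposite_free_extensions // natz.
suff -> : opposite_free_extensions W (cover G) k = set0 by rewrite cards0 mulr0.
apply/setP => K; rewrite !inE; apply: contraFF notG => /and4P[_ GK freeK /eqP <-].
by rewrite (opposite_freeS _ _ GK freeK) subset_leq_card.
Qed.

End OppositeFreeSets.

Arguments opposite_free_extensions {E}.

(** * Topes and halfspaces of a simple oriented matroid with a positive circuit *)

Section Committees.
Variables (E : finType) (M : oriented_matroid E).
Hypotheses (simpleM : simple_om M) (cyclicM : ~~ acyclic M).
Implicit Types (A B : {set E}) (K d : {set signvec E}) (G : {set {set signvec E}}).

Lemma tope_opp : {in topes M, forall T, svopp T \in topes M}.
Proof.
move=> T; rewrite !inE => /andP[TL /forall_inP maxT]; rewrite covectorN //=.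
apply/forall_inP => Y YL; apply/implyP => /forallP leTY.
have /implyP/(_ _)/eqP <- := maxT _ (covectorN YL); first by rewrite svoppK.
apply/forallP => e; have := leTY e; rewrite !ffunE.
by case: (T e) (Y e) => [] [].
Qed.

Lemma halfspace_sub_topes e : halfspace M e \subset topes M.
Proof. by apply/subsetP => T; rewrite inE => /andP[]. Qed.

Lemma cyclic_ground_nonempty : exists e : E, true.
Proof.
have /forall_inPn[X] := cyclicM; rewrite inE => /and3P[_ Xn0 _] _.
apply/existsP; apply: contraNT Xn0 => /existsPn noE.
by apply/eqP/ffunP => e; have := noE e.
Qed.

(** A nonzero nonnegative circuit cannot be orthogonal to an everywhere positive covector: some
    product is positive and none is negative. *)
Lemma cyclic_tope_not_positive T : T \in topes M -> exists e, T e != Pos.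
Proof.
rewrite inE => /andP[TL _].
have /forall_inPn[X] := cyclicM.
rewrite inE negbK => /and3P[+ Xn0 _] /eqP Xneg.
rewrite inE => /forall_inP/(_ T TL) orthXT.
apply/existsP; apply: contraT => /existsPn posT.
have {}posT e : T e = Pos by apply/eqP; rewrite -[_ == _]negbK posT.
have nneg e : X e != Neg by have := in_set0 e; rewrite -Xneg inE => ->.
case/orP: orthXT => [/forallP X0|/andP[_ /existsP[e]]].
  case/eqP: Xn0; apply/ffunP => e; rewrite ffunE.
  by have := X0 e; rewrite posT; case: (X e).
by rewrite posT; move: (nneg e); case: (X e).
Qed.

Lemma tope_opp_neq : {in topes M, forall T, svopp T != T}.
Proof.
have [e _] := cyclic_ground_nonempty.
move=> T TT; apply/eqP => /ffunP/(_ e); rewrite ffunE.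
by have := tope_neq0 simpleM e TT; case: (T e).
Qed.

(** Since topes have no zero entry, negation exchanges a halfspace with its complement in the
    topes. *)
Lemma topes_even : ~~ odd #|topes M|.
Proof.
have [e _] := cyclic_ground_nonempty.
suff -> : #|topes M| = #|halfspace M e|.*2 by rewrite odd_double.
rewrite -(cardsID (halfspace M e)) (setIidPr (halfspace_sub_topes e)) -addnn.
congr addn; rewrite -[RHS](card_imset _ (inv_inj (svoppK E))).
apply: eq_card => T; rewrite -[in RHS](svoppK E T) (mem_imset _ _ (inv_inj (svoppK E))).
have memN : (svopp T \in topes M) = (T \in topes M).
  by apply/idP/idP => /tope_opp; rewrite ?svoppK.
rewrite in_setD [T \in halfspace M e]in_set [svopp T \in halfspace M e]in_set memN ffunE.
case TT: (T \in topes M) => //=.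
by have := tope_neq0 simpleM e TT; case: (T e).
Qed.

Lemma halfspace_subsetsP j A d :
  reflect (exists2 e, e \in A & (d \subset halfspace M e) && (#|d| == j))
          (d \in halfspace_subsets M j A).
Proof.
apply: (iffP bigcupP) => -[e eA]; rewrite ?inE => de; exists e => //.
by rewrite inE.
Qed.

Lemma halfspace_subsets_sub_topes j A :
  {in halfspace_subsets M j A, forall d : {set signvec E}, d \subset topes M}.
Proof.
move=> d /halfspace_subsetsP[e _ /andP[de _]].
exact: subset_trans de (halfspace_sub_topes e).
Qed.

Lemma halfspace_subsetsS j A B :
  A \subset B -> halfspace_subsets M j A \subset halfspace_subsets M j B.
Proof.
move=> /subsetP AB; apply/subsetP => d /halfspace_subsetsP[e /AB eB de].
by apply/halfspace_subsetsP; exists e.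
Qed.

(** This translates between [j]-subsets inside [K] and the counting condition that defines
    committees. *)
Lemma halfspace_subsets_within j A K :
  ([set d in halfspace_subsets M j A | d \subset K] != set0) =
  [exists e in A, (j <= #|K :&: halfspace M e|)%N].
Proof.
apply/set0Pn/exists_inP => [[d]|[e eA lejK]].
  rewrite inE => /andP[/halfspace_subsetsP[e eA /andP[de /eqP <-]] dK].
  by exists e => //; rewrite subset_leq_card // subsetI dK.
have : (0 < #|[set d : {set signvec E} | d \subset K :&: halfspace M e & #|d| == j]|)%N.
  by rewrite cards_draws bin_gt0.
case/card_gt0P => d; rewrite inE subsetI => /andP[/andP[dK de] dj].
exists d; rewrite inE dK andbT; apply/halfspace_subsetsP; exists e => //.
by rewrite de.
Qed.

(** * The two formulas for the number of committees *)

Variable k : nat.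
Let j := uphalf k.+1.
Let V := signvec E.
(** For [u <= k] this is the number of opposite-free [k]-sets of topes containing a given
    opposite-free set of [u] topes. *)
Let N (u : nat) : int := (2 ^ (k - u) * 'C(#|topes M| %/ 2 - u, k - u))%N%:Z.
Let ksets := opposite_free_extensions (topes M) set0 k.

Lemma card_opposite_free_committees :
  #|opposite_free_committees M k|%:Z =
  \sum_(K in ksets) [forall e, (j <= #|K :&: halfspace M e|)%N]%:R.
Proof.
rewrite -sum1_card -natz natr_sum /= [LHS]big_mkcond [RHS]big_mkcond /=.
apply: eq_bigr => K _; rewrite !inE sub0set /=.
(* The size [j] is the least strict majority: [j <= n] means [k < 2 * n]. *)
under [in RHS]eq_forallb => e do rewrite leq_uphalf_double -mul2n.
case: (K \subset topes M); case: (#|K| == k); case: (opposite_free K);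
  by rewrite /= ?andbF ?andbT //; case: [forall e, _].
Qed.

(** The crosscut formula turns the left side into a sum over nonempty families, and
    [sum_opposite_free_sets] redistributes it over the sets [K]. The signs for one [K] then add up
    to -1 if some member of [G] lies in [K], and to 0 otherwise. *)
Lemma sum_posetE G : {in G, forall d : {set signvec E}, d \subset topes M} ->
    set0 \notin G ->
  \sum_(U in posetE G | (0 < #|U| <= k)%N) mobius_hat0 (posetE G) U * N #|U| =
  - \sum_(K in ksets) ([set d in G | d \subset K] != set0)%:R.
Proof.
move=> GT G0.
transitivity (\sum_(F : {set {set V}} |
    [&& F \subset G, opposite_free (cover F) & (#|cover F| <= k)%N])
    (if F != set0 then (-1) ^+ #|F| else 0) * N #|cover F|).
  rewrite [RHS](bigID (fun F => F != set0)) /= [X in _ = _ + X]big1 ?addr0; last first.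
    by move=> F /andP[_ /negPf ->]; rewrite mul0r.
  rewrite [RHS](partition_big (@cover V) (fun U => (U \in posetE G) && (0 < #|U| <= k)%N)) /=.
    apply: eq_bigr => U /andP[UE /andP[_ Uk]].
    rewrite (@mobius_hat0_unions _ (posetE G) G) //; last 2 first.
    - by apply/subsetP => V'; rewrite inE => /andP[].
    - move=> U' V'; rewrite !inE => /andP[_ freeU'] V'G /opposite_freeS.
      by rewrite V'G; apply.
    rewrite mulr_suml; apply: eq_big => F.
      case: (eqVneq (cover F) U) => [->|]; rewrite ?andbF // Uk.
      by move: UE; rewrite inE => /andP[_ ->]; rewrite !andbT.
    by case/and3P => _ -> /eqP ->.
  move=> F /andP[/and3P[FG freeF Fk] Fn0]; rewrite Fk andbT inE freeF andbT.
  apply/andP; split.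
    by apply/imsetP; exists F => //; rewrite !inE FG.
  (* A nonempty family has a nonempty union because [set0] is not in [G]; this gives the bound
     [0 < #|U|]. *)
  rewrite card_gt0; have [d dF] := set0Pn _ Fn0.
  apply: contraNneq G0 => covF0.
  suff <- : d = set0 by apply: (subsetP FG).
  by apply/eqP; rewrite -subset0 -covF0 (bigcup_sup d).
rewrite -(sum_opposite_free_sets _ _ tope_opp tope_opp_neq) //; last exact: topes_even.
rewrite -sumrN; apply: eq_bigr => K _.
by rewrite -big_mkcondr sum_sign_nonempty_subsets.
Qed.

(** Let [Z] collect the ground elements violating the committee condition for [K]. The Moebius
    numbers of the whole poset sum to -1, since it has a greatest member, and so do those below the
    member of [Z] when [Z] is nonempty. The families with no member inside [K] are exactly the
    latter ones. *)
Lemma sum_posetC K :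
  \sum_(G in posetC M j) mobius_hat0 (posetC M j) G *
      ([set d in G | d \subset K] != set0)%:R
  = - [forall e, (j <= #|K :&: halfspace M e|)%N]%:R.
Proof.
have [e0 _] := cyclic_ground_nonempty.
pose Z := [set e | ~~ (j <= #|K :&: halfspace M e|)%N].
have memC A : A != set0 -> halfspace_subsets M j A \in posetC M j.
  by move=> An0; apply/imsetP; exists A; rewrite ?inE.
have sumT : \sum_(G in posetC M j) mobius_hat0 (posetC M j) G = -1.
  rewrite -(mobius_hat0_sum _ _ _ (memC setT _)); last by apply/set0Pn; exists e0.
  apply: eq_bigl => G; apply/idP/andP => [GC|[]//]; split=> //.
  by case/imsetP: GC => A _ ->; apply/halfspace_subsetsS/subsetT.
have [allK|/forallPn[e1 Ke1]] := boolP [forall e, (j <= #|K :&: halfspace M e|)%N].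
  rewrite -sumT; apply: eq_bigr => G /imsetP[A]; rewrite !inE => /set0Pn[e eA] ->.
  rewrite halfspace_subsets_within; case: exists_inP => [_|[]]; first by rewrite mulr1.
  by exists e => //; apply: (forallP allK).
have Zn0 : Z != set0 by apply/set0Pn; exists e1; rewrite inE.
rewrite oppr0; have := mobius_hat0_sum _ _ _ (memC Z Zn0).
rewrite -sumT [X in _ = X](bigID (fun G => G \subset halfspace_subsets M j Z)) /=.
move/eqP; rewrite -subr_eq0 opprD addrA subrr add0r oppr_eq0 => /eqP sum0.
rewrite -[RHS]sum0 [RHS]big_mkcondr; apply: eq_bigr => G /imsetP[A]; rewrite !inE => An0 ->.
rewrite halfspace_subsets_within.
(* Families are compared rather than index sets, since different [A] may give the same family. *)
suff -> : (halfspace_subsets M j A \subset halfspace_subsets M j Z) =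
    ~~ [exists e in A, (j <= #|K :&: halfspace M e|)%N].
  by case: exists_inP => _ /=; rewrite ?mulr1 ?mulr0.
apply/idP/idP => [AZ|/exists_inPn AK].
  apply/negP; rewrite -halfspace_subsets_within => /set0Pn[d].
  rewrite inE => /andP[/(subsetP AZ) dZ dK].
  have : [set d in halfspace_subsets M j Z | d \subset K] != set0.
    by apply/set0Pn; exists d; rewrite inE dZ.
  rewrite halfspace_subsets_within => /exists_inP[e].
  by rewrite inE => /negP.
by apply/halfspace_subsetsS/subsetP => e eA; rewrite inE AK.
Qed.

(** By [gammaE], an element [e] lies in [gamma M d] exactly when [d] is contained in the halfspace
    of [e]. Covering [e] thus requires a [j]-subset of [K] in that halfspace. *)
Lemma cover_gamma_within K : K \subset topes M ->
  (cover [set gamma M d | d in [set d in halfspace_subsets M j setT | d \subset K]]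
     == setT) = [forall e, (j <= #|K :&: halfspace M e|)%N].
Proof.
move=> KT; rewrite -subTset; apply/subsetP/forallP => [covT e|leK e _].
  have /bigcupP[A /imsetP[d]] := covT e (in_setT e).
  rewrite inE => /andP[/halfspace_subsetsP[_ _ /andP[_ /eqP <-]] dK] ->.
  rewrite gammaE //; last exact: subset_trans KT.
  rewrite inE => /forall_inP de; apply/subset_leq_card/subsetP => T Td.
  by rewrite in_setI [T \in halfspace M e]in_set (subsetP KT) ?(subsetP dK) // de.
have : [set d in halfspace_subsets M j [set e] | d \subset K] != set0.
  by rewrite halfspace_subsets_within; apply/exists_inP; exists e; rewrite ?inE.
case/set0Pn => d; rewrite inE => /andP[de dK].
apply/bigcupP; exists (gamma M d).
  apply/imsetP; exists d => //; rewrite inE dK andbT.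
  by apply: (subsetP (halfspace_subsetsS _ _ _ (subsetT _))) de.
rewrite gammaE //; last exact: halfspace_subsets_sub_topes de.
rewrite inE; apply/forall_inP => T Td.
case/halfspace_subsetsP: de => e'; rewrite inE => /eqP -> /andP[/subsetP/(_ _ Td)].
by rewrite inE => /andP[].
Qed.

(** The bounds [1 < #|G| <= 'C(k, j)] are left out of the definition and derived in
    [covering_family_card]. *)
Definition covering_family G : bool :=
  [&& G \subset halfspace_subsets M j setT, opposite_free (cover G),
      cover (min_gamma M G) == setT & (#|cover G| <= k)%N].

Lemma min_gamma_sub G : min_gamma M G \subset [set gamma M d | d in G].
Proof. by apply/subsetP => A; rewrite inE => /minsetp. Qed.

(** The upper bound holds because members are [j]-subsets of [cover G]. For the lower bound, if [G]
    had a single member [d], every tope in [d] would be positive everywhere; such a tope exists as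
    [j] is positive, against cyclicity. *)
Lemma covering_family_card G :
  covering_family G -> (1 < #|G| <= 'C(k, j))%N.
Proof.
have [e0 _] := cyclic_ground_nonempty.
case/and4P => GD _ /eqP covG Gk; apply/andP; split; last first.
  apply: leq_trans (leq_bin2l j Gk); rewrite -cards_draws.
  apply/subset_leq_card/subsetP => d dG; rewrite inE (bigcup_sup d) //=.
  by case/halfspace_subsetsP: (subsetP GD _ dG) => e _ /andP[].
have covS : setT \subset cover [set gamma M d | d in G].
  rewrite -covG; apply/bigcupsP => A /(subsetP (min_gamma_sub G)) AG.
  exact: (bigcup_sup A).
rewrite ltnNge leq_eqVlt ltnS leqn0 negb_or; apply/andP; split; last first.
  rewrite cards_eq0; apply/eqP => G0.
  by have := subsetP covS e0; rewrite G0 imset0 /cover big_set0 !inE => /(_ isT).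
apply/cards1P => -[d Gd].
have dD : d \in halfspace_subsets M j setT by rewrite (subsetP GD) // Gd set11.
have /card_gt0P[T Td] : (0 < #|d|)%N.
  by case/halfspace_subsetsP: dD => e _ /andP[_ /eqP ->].
have dT := halfspace_subsets_sub_topes _ _ _ dD.
have [e] := cyclic_tope_not_positive _ (subsetP dT _ Td).
have /bigcupP[A] := subsetP covS e (in_setT e).
rewrite Gd imset_set1 => /set1P ->; rewrite gammaE // inE => /forall_inP/(_ _ Td) ->.
by [].
Qed.

Lemma mobius_posetS G : cover (min_gamma M G) = setT ->
  mobius_hat0 (posetS M G) setT =
  \sum_(F : {set {set E}} | (F \subset min_gamma M G) && (cover F == setT))
    (-1) ^+ #|F|.
Proof.
have [e0 _] := cyclic_ground_nonempty => covG.
(* The ground set is nonempty, so a covering family satisfies the nonemptiness condition of the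
   crosscut formula. *)
have n0 (F : {set {set E}}) : cover F = setT -> F != set0.
  by apply: contra_eqN => /eqP ->; rewrite /cover big_set0 eq_sym; apply/set0Pn; exists e0.
rewrite (@mobius_hat0_unions _ (posetS M G) (min_gamma M G)) //; last first.
  by apply/imsetP; exists (min_gamma M G); rewrite ?covG // !inE subxx n0.
apply: eq_bigl => F; congr (_ && _).
by case: (eqVneq (cover F) setT) => [/n0 ->|]; rewrite ?andbF.
Qed.

Lemma card_committees_posetC :
  #|opposite_free_committees M k|%:Z =
    \sum_(G in posetC M j) mobius_hat0 (posetC M j) G *
      \sum_(U in posetE G | (0 < #|U| <= k)%N)
        mobius_hat0 (posetE G) U * N #|U|.
Proof.
rewrite card_opposite_free_committees.
transitivity (\sum_(K in ksets) \sum_(G in posetC M j)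
   - (mobius_hat0 (posetC M j) G * ([set d in G | d \subset K] != set0)%:R)).
  by apply: eq_bigr => K _; rewrite sumrN sum_posetC opprK.
rewrite exchange_big /=; apply: eq_bigr => G /imsetP[A _ GA].
rewrite sum_posetE; first by rewrite sumrN mulrN mulr_sumr.
  by rewrite GA; apply: halfspace_subsets_sub_topes.
rewrite GA; apply/halfspace_subsetsP => -[e _]; rewrite cards0.
by case/andP.
Qed.

Lemma card_committees_posetS :
  #|opposite_free_committees M k|%:Z =
    \sum_(G : {set {set V}} | covering_family G)
      (-1) ^+ #|G| * mobius_hat0 (posetS M G) setT * N #|cover G|.
Proof.
rewrite card_opposite_free_committees.
transitivity (\sum_(K in ksets)
    \sum_(G : {set {set V}} |
          G \subset [set d in halfspace_subsets M j setT | d \subset K])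
      (-1) ^+ #|G| *
      \sum_(F : {set {set E}} | (F \subset min_gamma M G) && (cover F == setT))
        (-1) ^+ #|F| : int).
  apply: eq_bigr => K; rewrite inE => /and4P[KT _ _ _].
  (* The committee indicator of [K] becomes a double alternating sum whose inner sum is a crosscut
     sum for [posetS M G]. *)
  by rewrite -cover_gamma_within // -sum_sign_min_members.
rewrite (sum_opposite_free_sets _ _ tope_opp tope_opp_neq); last 2 first.
- exact: topes_even.
- exact: halfspace_subsets_sub_topes.
rewrite big_mkcond [RHS]big_mkcond /=; apply: eq_bigr => G _.
rewrite /covering_family; case: (eqVneq (cover (min_gamma M G)) setT) => [covG|ncov].
  by rewrite mobius_posetS.
(* If [min_gamma M G] does not cover, no subfamily does, and the inner sum is empty. *)
rewrite !andbF; case: ifP => // _; rewrite big_pred0 ?mulr0 ?mul0r // => F.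
apply: contraNF ncov => /andP[sF /eqP covF]; rewrite -subTset -covF.
by apply/bigcupsP => A /(subsetP sF) AG; apply: (bigcup_sup A).
Qed.

(** The members of [min_gamma M G] are singletons covering the ground set, so there are at least
    [#|E|] of them, each the image of a member of [G]. *)
Lemma covering_family_singletons G :
    covering_family G -> {in G, forall d, #|gamma M d| = 1%N} ->
  (#|E| <= #|G|)%N /\ mobius_hat0 (posetS M G) setT = (-1) ^+ #|E|.
Proof.
have [e0 _] := cyclic_ground_nonempty.
case/and4P => _ _ /eqP covG _ G1.
have min1 : {in min_gamma M G, forall A : {set E}, #|A| = 1%N}.
  by move=> A /(subsetP (min_gamma_sub G))/imsetP[d dG ->]; apply: G1.
split; last first.
  by apply: mobius_hat0_unions_singletons => //; apply/set0Pn; exists e0.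
rewrite -cardsT -covG.
apply: leq_trans (leq_imset_card (gamma M) (mem G)).
apply: leq_trans (subset_leq_card (min_gamma_sub G)).
apply: leq_trans (leq_card_cover _) _.
by rewrite (eq_bigr (fun=> 1%N)) ?sum1_card.
Qed.

End Committees.

Theorem theorem6p1 (t : nat) (M : oriented_matroid 'I_t) (k : nat)
    (simpleM : simple_om M) (cyclicM : ~~ acyclic M)
    (k_ge3 : (3 <= k)%N) (k_le : (2 * k <= #|topes M|)%N) :
  let j := uphalf k.+1 in
  let V := signvec 'I_t in
  let N := fun u : nat =>
    (2 ^ (k - u) * 'C(#|topes M| %/ 2 - u, k - u))%N%:Z in
  let admissible := fun G : {set {set V}} =>
    [&& G \subset halfspace_subsets M j setT, opposite_free (cover G),
        cover (min_gamma M G) == setT & (#|cover G| <= k)%N] in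
  [/\ #|opposite_free_committees M k|%:Z =
        \sum_(G in posetC M j)
          mobius_hat0 (posetC M j) G *
          \sum_(U in posetE G | (0 < #|U| <= k)%N)
            mobius_hat0 (posetE G) U * N #|U|,
      #|opposite_free_committees M k|%:Z =
        \sum_(G : {set {set V}} |
              admissible G && (1 < #|G| <= 'C(k, j))%N)
          (-1) ^+ #|G| * mobius_hat0 (posetS M G) setT * N #|cover G|
    & (forall G : {set {set V}}, admissible G ->
         forall d, d \in G -> #|gamma M d| = 1%N) ->
      #|opposite_free_committees M k|%:Z =
        (-1) ^+ t *
        \sum_(G : {set {set V}} |
              admissible G && (t <= #|G| <= 'C(k, j))%N)
          (-1) ^+ #|G| * N #|cover G|].
Proof.
move=> j V N admissible; split.
- exact: card_committees_posetC.
- rewrite card_committees_posetS //; apply: eq_bigl => G.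
  apply/idP/andP => [admG|[]//]; split=> //.
  exact: (covering_family_card _ _ simpleM cyclicM).
(* The singleton hypothesis gives both the lower bound [t] on [#|G|] and the constant Moebius
   number, whose sign is pulled out of the sum. *)
move=> gamma1; rewrite card_committees_posetS // mulr_sumr.
apply: eq_big => G.
  apply/idP/andP => [admG|[]//]; split=> //.
  have [leG _] := covering_family_singletons _ _ cyclicM _ _ admG (gamma1 _ admG).
  have /andP[_ ->] := covering_family_card _ _ simpleM cyclicM _ _ admG.
  by rewrite andbT; rewrite card_ord in leG.
move=> admG.
have [_ ->] := covering_family_singletons _ _ cyclicM _ _ admG (gamma1 _ admG).
by rewrite card_ord [(-1) ^+ #|G| * _]mulrC mulrA.
Qed.
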